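(* Let $(M,g)$ be a time-orientable Lorentzian surface. Then $(M,g)$ is conformally flat if and only if $(M,g)$ is both $\mathcal{X}$-conformally flat and $\mathcal{Y}$-conformally flat.
   Context: A Lorentzian surface $(M,g)$ is a smooth oriented $2$-manifold with a metric of signature $(1,1)$; in an orthonormal basis $(s_1,s_2)$ the vector $s_1$ is timelike ($g(s_1,s_1)=-1$) and $s_2$ is spacelike ($g(s_2,s_2)=1$). It is time-orientable if it admits a nowhere vanishing timelike vector field (equivalently a global orthonormal frame). For an oriented orthonormal frame $s=(s_1,s_2)$ put $X_s=s_1+s_2$ and $Y_s=-s_1+s_2$. A time-orientable $(M,g)$ is $\mathcal{X}$-conformally flat (resp. $\mathcal{Y}$-conformally flat) if there is a global oriented orthonormal frame $s$ with $\mathrm{div}(X_s)=0$ (resp. a global oriented orthonormal frame $s$ with $\mathrm{div}(Y_s)=0$). $(M,g)$ is conformally flat if there is a smooth function $\lambda>0$ on $M$ such that $\lambda g$ is flat (globally).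
   Formalization: ''λg is flat (globally)'' is taken to mean that λg has a parallel oriented orthonormal frame on all of M, which is stronger than zero curvature; with zero curvature only, the claim fails for {u>0}/((u,v)~(2u,v/2)) with metric du dv. *)

(* Defs.v *)
From HB Require Import structures.
From mathcomp Require Import all_boot all_order all_algebra.
From mathcomp Require Import all_classical all_reals all_analysis.

Set Implicit Arguments.
Unset Strict Implicit.
Unset Printing Implicit Defensive.

Import Order.TTheory GRing.Theory Num.Theory.
Import numFieldNormedType.Exports.

Local Open Scope classical_set_scope.
Local Open Scope ring_scope.

Section Calculus.
Variable R : realType.

Definition pderiv (i : 'I_2) (f : 'rV[R]_2 -> R) : 'rV[R]_2 -> R :=
  fun x => 'D_(delta_mx 0 i) f x.

Fixpoint Ck_on (k : nat) (U : set 'rV[R]_2) (f : 'rV[R]_2 -> R) : Prop :=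
  match k with
  | 0 => forall x, U x -> {for x, continuous f}
  | k'.+1 => [/\ forall x, U x -> {for x, continuous f},
                 forall i x, U x -> derivable f x (delta_mx 0 i)
               & forall i, Ck_on k' U (pderiv i f)]
  end.

(* Only used for open U, so that the values of f off U play no role. *)
Definition smooth_on (U : set 'rV[R]_2) (f : 'rV[R]_2 -> R) : Prop :=
  forall k, Ck_on k U f.

Definition smooth_mx_on m n (U : set 'rV[R]_2) (F : 'rV[R]_2 -> 'M[R]_(m, n)) :
    Prop :=
  forall a b, smooth_on U (fun x => F x a b).

End Calculus.

(* The orientation is the one for which all charts of the atlas are positive.
   [coord i] and [param i] are total functions; only their restrictions to
   [dom i] and [cod i] are meaningful. *)
Record oriented_surface (R : realType) := OrientedSurface {
  point :> topologicalType;
  point_hausdorff : hausdorff_space point;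
  point_second_countable : @second_countable point;
  atlas : Type;
  dom : atlas -> set point;
  cod : atlas -> set 'rV[R]_2;
  coord : atlas -> point -> 'rV[R]_2;
  param : atlas -> 'rV[R]_2 -> point;
  dom_open : forall i, open (dom i);
  cod_open : forall i, open (cod i);
  coord_cod : forall i p, dom i p -> cod i (coord i p);
  param_dom : forall i x, cod i x -> dom i (param i x);
  coordK : forall i p, dom i p -> param i (coord i p) = p;
  paramK : forall i x, cod i x -> coord i (param i x) = x;
  coord_continuous : forall i p, dom i p -> {for p, continuous (coord i)};
  param_continuous : forall i x, cod i x -> {for x, continuous (param i)};
  atlas_cover : forall p, exists i, dom i p;
  transition_smooth : forall i j,
    smooth_mx_on (cod i `&` param i @^-1` dom j) (coord j \o param i);
  transition_oriented : forall i j x, cod i x -> dom j (param i x) ->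
    0 < \det (jacobian (coord j \o param i) x)
}.

Arguments atlas {R} o.
Arguments dom {R o} _ _.
Arguments cod {R o} _ _.
Arguments coord {R o} _ _.
Arguments param {R o} _ _.

Section Lorentz.
Variables (R : realType) (M : oriented_surface R).

(* The jacobian of the library acts on row vectors by right multiplication. *)
Definition transition_jac (i j : atlas M) (x : 'rV[R]_2) : 'M[R]_2 :=
  jacobian (coord j \o param i) x.

(* Tensor fields are families of components: [V i x] and [g i x] are the
   components at the point [param i x] with respect to the coordinates
   [coord i]; they only matter for [x] in [cod i]. *)
Definition vfield_components := atlas M -> 'rV[R]_2 -> 'rV[R]_2.
Definition metric_components := atlas M -> 'rV[R]_2 -> 'M[R]_2.

Definition smooth_function (f : M -> R) : Prop :=
  forall i, smooth_on (cod i) (f \o param i).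

Definition vector_field (V : vfield_components) : Prop :=
  (forall i, smooth_mx_on (cod i) (V i)) /\
  (forall i j x, cod i x -> dom j (param i x) ->
     V j (coord j (param i x)) = V i x *m transition_jac i j x).

Definition inner (g : metric_components) (i : atlas M) (x v w : 'rV[R]_2) : R :=
  (v *m g i x *m w^T) 0 0.

Definition orthonormal (g : metric_components) i x (v w : 'rV[R]_2) : Prop :=
  [/\ inner g i x v v = -1, inner g i x w w = 1 & inner g i x v w = 0].

(* A symmetric bilinear form on a plane has signature (1,1) when it admits an
   orthonormal basis in the above sense. *)
Definition lorentzian_metric (g : metric_components) : Prop :=
  [/\ forall i, smooth_mx_on (cod i) (g i),
      forall i j x, cod i x -> dom j (param i x) ->
        g i x = transition_jac i j x *m g j (coord j (param i x))
                  *m (transition_jac i j x)^T,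
      forall i x, cod i x -> (g i x)^T = g i x
    & forall i x, cod i x -> exists v w, orthonormal g i x v w].

Definition time_orientable (g : metric_components) : Prop :=
  exists T, vector_field T /\
    forall i x, cod i x -> T i x != 0 /\ inner g i x (T i x) (T i x) < 0.

Definition oriented_orthonormal_frame (g : metric_components)
    (s1 s2 : vfield_components) : Prop :=
  [/\ vector_field s1, vector_field s2,
      forall i x, cod i x -> orthonormal g i x (s1 i x) (s2 i x)
    & forall i x, cod i x -> 0 < \det (col_mx (s1 i x) (s2 i x) : 'M[R]_(1 + 1))].

Definition frameX (s1 s2 : vfield_components) : vfield_components :=
  fun i x => s1 i x + s2 i x.
Definition frameY (s1 s2 : vfield_components) : vfield_components :=
  fun i x => - s1 i x + s2 i x.

(* Christoffel symbol Gamma^k_{ab} of the Levi-Civita connection in the chart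
   [i]. *)
Definition christoffel (g : metric_components) (i : atlas M) (k a b : 'I_2)
    (x : 'rV[R]_2) : R :=
  2^-1 * \sum_(l < 2) invmx (g i x) k l *
    (pderiv a (fun y => g i y b l) x + pderiv b (fun y => g i y a l) x
     - pderiv l (fun y => g i y a b) x).

(* Row [a] holds the components of nabla_{d/dx^a} V. *)
Definition covariant_derivative (g : metric_components) (V : vfield_components)
    (i : atlas M) (x : 'rV[R]_2) : 'M[R]_2 :=
  \matrix_(a < 2, k < 2)
    (pderiv a (fun y => V i y 0 k) x
     + \sum_(b < 2) christoffel g i k a b x * V i x 0 b).

Definition divergence (g : metric_components) (V : vfield_components)
    (i : atlas M) (x : 'rV[R]_2) : R :=
  \tr (covariant_derivative g V i x).

Definition parallel (g : metric_components) (V : vfield_components) : Prop :=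
  forall i x, cod i x -> covariant_derivative g V i x = 0.

Definition X_conformally_flat (g : metric_components) : Prop :=
  exists s1 s2, oriented_orthonormal_frame g s1 s2 /\
    forall i x, cod i x -> divergence g (frameX s1 s2) i x = 0.

Definition Y_conformally_flat (g : metric_components) : Prop :=
  exists s1 s2, oriented_orthonormal_frame g s1 s2 /\
    forall i x, cod i x -> divergence g (frameY s1 s2) i x = 0.

(* Flat in the global sense: a parallel orthonormal frame exists on all of M,
   i.e. the Levi-Civita connection is the trivial flat connection. Vanishing
   curvature only provides such frames locally. The global notion is the one
   that goes with global frames: the quotient of {(u,v) | u > 0} with metric
   du dv by (u,v) ~ (2u,v/2) is time-orientable and has zero curvature, but a
   divergence-free null field along the u-direction has the form a(v) d/du with
   a(v/2) = 2 a(v), so it vanishes on the closed leaf v = 0. *)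
Definition globally_flat (g : metric_components) : Prop :=
  exists s1 s2,
    [/\ oriented_orthonormal_frame g s1 s2, parallel g s1 & parallel g s2].

Definition rescale (f : M -> R) (g : metric_components) : metric_components :=
  fun i x => f (param i x) *: g i x.

Definition conformally_flat (g : metric_components) : Prop :=
  exists f : M -> R, [/\ smooth_function f, forall p, 0 < f p
    & globally_flat (rescale f g)].

End Lorentz.

(* Main.v *)
(* An oriented orthonormal frame is the same thing as a positive null frame
   (X, Y) with g(X, Y) = 2.  In such a frame nabla X = w X and nabla Y = - w Y
   for a 1-form w, so that div X = w(X) and div Y = - w(Y): the frame is
   parallel exactly when both fields are divergence free.  Since
   f div_{fg} V = div_g (f V), a null frame (X, Y) of fg that is parallel yields
   the null frames (fX, Y) and (X, fY) of g with div_g (fX) = 0 and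
   div_g (fY) = 0.  Conversely, two null frames (X1, Y1) and (X2, Y2) of g
   satisfy Y2 = k Y1 for a nowhere vanishing function k; if div_g X1 = 0 and
   div_g Y2 = 0, then (X1 / |k|, Y1) is a parallel null frame of |k| g. *)

Require Import Defs.
From mathcomp Require Import all_boot all_order all_algebra.
From mathcomp Require Import all_classical all_reals all_analysis.
From mathcomp Require Import ring lra.

Set Implicit Arguments.
Unset Strict Implicit.
Unset Printing Implicit Defensive.

Import Order.TTheory GRing.Theory Num.Theory.
Import numFieldNormedType.Exports.

Local Open Scope classical_set_scope.
Local Open Scope ring_scope.

(** * Calculus of smooth functions on an open subset of the plane *)

Section SmoothFunctions.
Variables (R : realType) (U : set 'rV[R]_2).
Hypothesis openU : open U.
Implicit Types (f h : 'rV[R]_2 -> R) (x : 'rV[R]_2) (a : 'I_2).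

Lemma near_eq_on f h x : (forall y, U y -> f y = h y) -> U x ->
  \forall y \near x, f y = h y.
Proof.
move=> fh Ux; have : \forall y \near x, U y by exact: open_nbhs_nbhs.
by apply: filterS => y /fh.
Qed.

Lemma pderiv_eq_on a f h x : (forall y, U y -> f y = h y) -> U x ->
  pderiv a f x = pderiv a h x.
Proof. by move=> fh Ux; apply: near_eq_derive; exact: near_eq_on. Qed.

Lemma pderiv_cst_on a f (c : R) x : (forall y, U y -> f y = c) -> U x ->
  pderiv a f x = 0.
Proof.
by move=> fc Ux; rewrite (@pderiv_eq_on a f (cst c))// /pderiv derive_cst.
Qed.

Lemma pderivD a f h x : derivable f x (delta_mx 0 a) ->
  derivable h x (delta_mx 0 a) ->
  pderiv a (fun y => f y + h y) x = pderiv a f x + pderiv a h x.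
Proof. by move=> df dh; rewrite /pderiv -deriveD. Qed.

Lemma pderivM a f h x : derivable f x (delta_mx 0 a) ->
  derivable h x (delta_mx 0 a) ->
  pderiv a (fun y => f y * h y) x = pderiv a f x * h x + f x * pderiv a h x.
Proof.
move=> df dh; have := deriveM df dh.
by rewrite /pderiv => ->; rewrite addrC [h x *: _]mulrC.
Qed.

Lemma near_eq_continuous f h x : (\forall y \near x, f y = h y) ->
  {for x, continuous f} -> {for x, continuous h}.
Proof.
move=> fh; rewrite /prop_for /continuous_at -(nbhs_singleton fh).
by apply: cvg_trans; exact: (near_eq_cvg fh).
Qed.

(** Openness of [U] turns equality on [U] into equality near each point of [U], so limits and
    derivatives agree as well. This lets the differentiation rules, which hold only on [U], be used
    under [Ck_on], whose argument is a total function. *)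
Lemma Ck_on_eq k f h : (forall x, U x -> f x = h x) ->
  Ck_on k U f -> Ck_on k U h.
Proof.
elim: k f h => [|k IH] f h fh /=.
  by move=> cf x Ux; apply: near_eq_continuous (cf x Ux); exact: near_eq_on.
move=> [cf df kf]; split.
- by move=> x Ux; apply: near_eq_continuous (cf x Ux); exact: near_eq_on.
- move=> a x Ux; apply: near_eq_derivable (df a x Ux); exact: near_eq_on.
- by move=> a; apply: IH (kf a) => x Ux; exact: pderiv_eq_on.
Qed.

Lemma Ck_onW k f : Ck_on k.+1 U f -> Ck_on k U f.
Proof.
elim: k f => [|k IH] f; first by case.
by move=> [cf df kf]; split=> // a; exact/IH/kf.
Qed.

Lemma Ck_onD k f h : Ck_on k U f -> Ck_on k U h ->
  Ck_on k U (fun x => f x + h x).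
Proof.
elim: k f h => [|k IH] f h.
  by move=> cf ch x Ux; apply: continuousD; [exact: cf|exact: ch].
move=> [cf df kf] [ch dh kh]; split.
- by move=> x Ux; apply: continuousD; [exact: cf|exact: ch].
- by move=> a x Ux; apply: derivableD; [exact: df|exact: dh].
- move=> a; apply: Ck_on_eq (IH _ _ (kf a) (kh a)) => x Ux.
  by rewrite pderivD; [|exact: df|exact: dh].
Qed.

Lemma Ck_onM k f h : Ck_on k U f -> Ck_on k U h ->
  Ck_on k U (fun x => f x * h x).
Proof.
elim: k f h => [|k IH] f h.
  by move=> cf ch x Ux; apply: continuousM; [exact: cf|exact: ch].
(* The product rule multiplies a derivative by an undifferentiated factor, so the induction
   hypothesis also needs [f] and [h] themselves at order [k]. *)
move=> kf1 kh1; move: (Ck_onW kf1) (Ck_onW kh1) => kf' kh'.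
move: kf1 kh1 => [cf df kf] [ch dh kh]; split.
- by move=> x Ux; apply: continuousM; [exact: cf|exact: ch].
- by move=> a x Ux; apply: derivableM; [exact: df|exact: dh].
- move=> a; have := Ck_onD (IH _ _ (kf a) kh') (IH _ _ kf' (kh a)).
  apply: Ck_on_eq => x Ux.
  by rewrite pderivM; [|exact: df|exact: dh].
Qed.

(** Local constancy, rather than constancy, is what holds for the sign of a nonvanishing function:
    it may differ from one component of [U] to another. *)
Lemma Ck_on_locally_constant k f :
  (forall x, U x -> \forall y \near x, f y = f x) -> Ck_on k U f.
Proof.
have cst_cont h x : (\forall y \near x, h y = h x) -> {for x, continuous h}.
  move=> hx; apply: (@near_eq_continuous (cst (h x)));
    last exact: cst_continuous.
  by apply: filterS hx => y ->.
elim: k f => [|k IH] f fc; first by move=> x Ux; apply: cst_cont; exact: fc.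
split.
- by move=> x Ux; apply: cst_cont; exact: fc.
- move=> a x Ux.
  apply: near_eq_derivable (derivable_cst (f x) x (delta_mx 0 a)).
  by apply: filterS (fc x Ux) => y ->.
- have df0 a x : U x -> pderiv a f x = 0.
    move=> Ux; rewrite /pderiv.
    rewrite (near_eq_derive _ (g := cst (f x))) ?derive_cst//.
    exact: fc.
  move=> a; apply: IH => x Ux; rewrite df0//.
  exact: (@near_eq_on (pderiv a f) (fun=> 0)) (df0 a) Ux.
Qed.

Lemma Ck_onV k f : (forall x, U x -> f x != 0) -> Ck_on k U f ->
  Ck_on k U (fun x => (f x)^-1).
Proof.
move=> f0; elim: k => [|k IH].
  by move=> cf x Ux; apply: continuousV; [exact: f0|exact: cf].
move=> kf1; have kV := IH (Ck_onW kf1); case: kf1 => cf df kf; split.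
- by move=> x Ux; apply: continuousV; [exact: f0|exact: cf].
- by move=> a x Ux; apply: derivableV; [exact: f0|exact: df].
- have kN1 : Ck_on k U (fun=> -1).
    by apply: Ck_on_locally_constant => x Ux; near=> y.
  (* The derivative of [1/f] is [-(1/f)(1/f)f'], a product of functions already known to be of order
     [k]. *)
  move=> a; apply: Ck_on_eq (Ck_onM kN1 (Ck_onM (Ck_onM kV kV) (kf a))) => x Ux.
  rewrite /pderiv deriveV; [|exact: f0|exact: df].
  by rewrite mulN1r scaleNr -expr2 exprVn.
Unshelve. all: by end_near. Qed.

Lemma smooth_on_eq f h : (forall x, U x -> f x = h x) ->
  smooth_on U f -> smooth_on U h.
Proof. by move=> fh sf k; exact: Ck_on_eq (sf k). Qed.

Lemma smooth_on_continuous f x : smooth_on U f -> U x -> {for x, continuous f}.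
Proof. by move=> /(_ 0)+ Ux; exact. Qed.

Lemma smooth_on_derivable f x a : smooth_on U f -> U x ->
  derivable f x (delta_mx 0 a).
Proof. by move=> /(_ 1)[_ df _] Ux; exact: df. Qed.

Lemma smooth_onD f h : smooth_on U f -> smooth_on U h ->
  smooth_on U (fun x => f x + h x).
Proof. by move=> sf sh k; exact: Ck_onD. Qed.

Lemma smooth_onM f h : smooth_on U f -> smooth_on U h ->
  smooth_on U (fun x => f x * h x).
Proof. by move=> sf sh k; exact: Ck_onM. Qed.

Lemma smooth_onV f : (forall x, U x -> f x != 0) -> smooth_on U f ->
  smooth_on U (fun x => (f x)^-1).
Proof. by move=> f0 sf k; exact: Ck_onV. Qed.

Lemma smooth_on_cst (c : R) : smooth_on U (fun=> c).
Proof.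
by move=> k; apply: Ck_on_locally_constant => x Ux; near=> y.
Unshelve. all: by end_near. Qed.

Lemma near_sg_cst f x : smooth_on U f -> U x -> f x != 0 ->
  \forall y \near x, Num.sg (f y) = Num.sg (f x).
Proof.
move=> sf Ux; have cf := smooth_on_continuous sf Ux.
case: ltgtP => // fx _.
- have : \forall y \near x, f y < 0 by apply: (cvgr_lt _ cf).
  by apply: filterS => y fy; rewrite !ltr0_sg.
- have : \forall y \near x, 0 < f y by apply: (cvgr_gt _ cf).
  by apply: filterS => y fy; rewrite !gtr0_sg.
Qed.

Lemma smooth_on_sg f : (forall x, U x -> f x != 0) -> smooth_on U f ->
  smooth_on U (fun x => Num.sg (f x)).
Proof.
move=> f0 sf k; apply: Ck_on_locally_constant => x Ux.
exact: near_sg_cst (f0 _ Ux).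
Qed.

Lemma smooth_on_norm f : (forall x, U x -> f x != 0) -> smooth_on U f ->
  smooth_on U (fun x => `|f x|).
Proof.
move=> f0 sf; under eq_fun do rewrite normrEsg.
by apply: smooth_onM => //; exact: smooth_on_sg.
Qed.

End SmoothFunctions.

(** * Linear algebra of a Lorentzian plane and its null lines *)

Section MetricAlgebra.
Variables (R : realType) (M : oriented_surface R).
Implicit Types (g : metric_components M) (i : atlas M) (x u v w : 'rV[R]_2).

(** This form of the orientation determinant keeps the dimension [1 + 1] of [col_mx] out of the
    computations. *)
Definition cross (v w : 'rV[R]_2) : R := v 0 0 * w 0 1 - v 0 1 * w 0 0.

Lemma big_I2 (V : nmodType) (F : 'I_2 -> V) : \sum_(l < 2) F l = F 0 + F 1.
Proof.
rewrite !big_ord_recl big_ord0 addr0; congr (F _ + F _); exact/val_inj.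
Qed.

Lemma ord2_ind (P : 'I_2 -> Prop) : P 0 -> P 1 -> forall a, P a.
Proof.
move=> P0 P1 [[|[|//]] lt2]; [rewrite (_ : Ordinal _ = 0)//|
  rewrite (_ : Ordinal _ = 1)//]; exact: val_inj.
Qed.

Lemma det_mx22 (A : 'M[R]_2) : \det A = A 0 0 * A 1 1 - A 0 1 * A 1 0.
Proof.
rewrite (expand_det_row _ 0) big_I2 /cofactor !det_mx11 !mxE /= addn0.
rewrite expr0 expr1 mul1r mulN1r mulrN.
by congr (_ * _ - _ * _); congr (A _ _); exact: val_inj.
Qed.

Lemma det_col_mx_cross v w : \det (col_mx v w : 'M[R]_(1 + 1)) = cross v w.
Proof.
have Eu j : col_mx v w 0 j = v 0 j.
  by rewrite -(col_mxEu v w 0 j); congr (col_mx v w _ _); exact: val_inj.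
have Ed j : col_mx v w 1 j = w 0 j.
  by rewrite -(col_mxEd v w 0 j); congr (col_mx v w _ _); exact: val_inj.
apply: etrans (det_mx22 _) _.
by congr (_ * _ - _ * _); [exact: Eu|exact: Ed|exact: Eu|exact: Ed].
Qed.

Lemma crossZl (c : R) v w : cross (c *: v) w = c * cross v w.
Proof. by rewrite /cross !mxE; ring. Qed.

Lemma crossZr (c : R) v w : cross v (c *: w) = c * cross v w.
Proof. by rewrite /cross !mxE; ring. Qed.

Lemma rV2P v w : v 0 0 = w 0 0 -> v 0 1 = w 0 1 -> v = w.
Proof. by move=> e0 e1; apply/rowP; exact: ord2_ind. Qed.

Lemma innerE g i x v w : inner g i x v w =
  v 0 0 * g i x 0 0 * w 0 0 + v 0 0 * g i x 0 1 * w 0 1 +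
  v 0 1 * g i x 1 0 * w 0 0 + v 0 1 * g i x 1 1 * w 0 1.
Proof. by rewrite /inner mxE big_I2 !mxE !big_I2; ring. Qed.

Lemma innerDl g i x u v w :
  inner g i x (u + v) w = inner g i x u w + inner g i x v w.
Proof. by rewrite /inner !mulmxDl mxE. Qed.

Lemma innerDr g i x u v w :
  inner g i x w (u + v) = inner g i x w u + inner g i x w v.
Proof. by rewrite /inner linearD/= mulmxDr mxE. Qed.

Lemma innerZl g i x (c : R) v w : inner g i x (c *: v) w = c * inner g i x v w.
Proof. by rewrite /inner -!scalemxAl mxE. Qed.

Lemma innerZr g i x (c : R) v w : inner g i x v (c *: w) = c * inner g i x v w.
Proof. by rewrite /inner linearZ/= -scalemxAr mxE. Qed.

Lemma innerNl g i x v w : inner g i x (- v) w = - inner g i x v w.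
Proof. by rewrite -scaleN1r innerZl mulN1r. Qed.

Lemma innerNr g i x v w : inner g i x v (- w) = - inner g i x v w.
Proof. by rewrite -scaleN1r innerZr mulN1r. Qed.

Lemma inner_rescale (f : M -> R) g i x v w :
  inner (rescale f g) i x v w = f (param i x) * inner g i x v w.
Proof. by rewrite /inner /rescale -scalemxAr -scalemxAl mxE. Qed.

(** The pointwise conditions on [(X, Y) = (s1 + s2, - s1 + s2)]: the value 2 is
    [g(s2,s2) - g(s1,s1)], and [cross X Y] is twice [cross s1 s2], so the orientation is kept. *)
Definition null_pair g i x v w :=
  [/\ inner g i x v v = 0, inner g i x w w = 0, inner g i x v w = 2
    & 0 < cross v w].

Section AtPoint.
Variables (g : metric_components M) (i : atlas M) (x : 'rV[R]_2).
Hypothesis g_sym : (g i x)^T = g i x.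

Lemma metric10 : g i x 1 0 = g i x 0 1.
Proof. by rewrite -[in LHS]g_sym mxE. Qed.

Lemma innerC v w : inner g i x v w = inner g i x w v.
Proof. by rewrite !innerE metric10; ring. Qed.

(** The Gram matrix of [(v, w)] is [A g A^T], where [A] has rows [v] and [w]. For an orthonormal
    pair its determinant is -1, which makes the metric nondegenerate. *)
Lemma metric_det_cross v w : \det (g i x) * cross v w ^+ 2 =
  inner g i x v v * inner g i x w w - inner g i x v w ^+ 2.
Proof. by rewrite det_mx22 /cross !innerE metric10; ring. Qed.

Lemma orthonormal_unitmx v w : Defs.orthonormal g i x v w -> g i x \in unitmx.
Proof.
move=> [vv ww vw]; rewrite unitmxE unitfE; apply/eqP => d0.
by have := metric_det_cross v w; rewrite d0 vv ww vw; lra.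
Qed.

(** Pairing [u] with one null vector kills the component along that vector and doubles the other
    one. *)
Lemma null_pair_decomp v w u : null_pair g i x v w ->
  u = (inner g i x u w / 2) *: v + (inner g i x u v / 2) *: w.
Proof.
move=> [vv ww vw vw0]; have wv : inner g i x w v = 2 by rewrite innerC.
have [a [b ->]] : exists a b, u = a *: v + b *: w.
  have c0 : cross v w != 0 by rewrite gt_eqF.
  (* Cramer's rule. *)
  exists (cross u w / cross v w), (cross v u / cross v w).
  by apply: rV2P; rewrite !mxE; move: c0; rewrite /cross => c0; field.
rewrite !innerDl !innerZl vv ww vw wv !mulr0 addr0 add0r.
by rewrite !mulfK.
Qed.

(* The orientation excludes the other null line. *)
Lemma null_pairs_aligned v w v' w' :
  null_pair g i x v w -> null_pair g i x v' w' ->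
  w' = (inner g i x v w' / 2) *: w.
Proof.
move=> vwP; have := null_pair_decomp w' vwP; have := null_pair_decomp v' vwP.
move: (_ / 2) (_ / 2) => d c v'E; rewrite [inner g i x v w']innerC.
move: (_ / 2) (_ / 2) => b a w'E [_].
move: vwP => [vv ww vw vw0]; have wv : inner g i x w v = 2 by rewrite innerC.
rewrite v'E w'E !innerDl !innerDr !innerZl !innerZr vv ww vw wv.
rewrite !mulr0 !addr0 !add0r => ab0 cd2 cr.
(* Nullity of [w' = a v + b w] forces [a b = 0]. If [b = 0], then [g(v',w') = 2] gives [d a = 1],
   and [cross v' w' = - cross v w] is negative, against the orientation of [(v', w')]. *)
suff -> : a = 0 by rewrite scale0r add0r.
have /eqP : a * b = 0 by lra.
rewrite mulf_eq0 => /orP[/eqP//|/eqP b0].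
have ad1 : d * a = 1 by move: cd2; rewrite b0; lra.
have crE : cross (c *: v + d *: w) (a *: v + b *: w) = - (d * a) * cross v w.
  by rewrite b0 /cross !mxE; ring.
by move: cr; rewrite crE ad1; lra.
Qed.

End AtPoint.

End MetricAlgebra.

(** * Conformal rescaling, pairings of vector fields, and compatibility of the connection with the
    metric *)

Section Connection.
Variables (R : realType) (M : oriented_surface R).
Implicit Types (g : metric_components M) (V W X Y : vfield_components M).
Implicit Types (i : atlas M) (f : M -> R).

Lemma lorentzian_unitmx g i x : lorentzian_metric g -> cod i x ->
  g i x \in unitmx.
Proof.
move=> [_ _ gs gl] ix; have [v [w vw]] := gl i x ix.
exact: (orthonormal_unitmx (gs i x ix) vw).
Qed.

Lemma lorentzian_rescale f g : smooth_function f -> (forall p, 0 < f p) ->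
  lorentzian_metric g -> lorentzian_metric (rescale f g).
Proof.
move=> sf f0 [sg gt gs gl]; split.
- move=> i a b; rewrite /rescale; under eq_fun do rewrite mxE.
  by apply: smooth_onM; [exact: cod_open|exact: sf|exact: sg].
- move=> i j x ix jx; rewrite /rescale coordK// [in LHS](gt i j)//.
  by rewrite -scalemxAr -scalemxAl.
- by move=> i x ix; rewrite /rescale linearZ/= gs.
- move=> i x ix; have [v [w [vv ww vw]]] := gl i x ix.
  (* An orthonormal basis of [g] divided by the square root of [f] is orthonormal for [f g]. *)
  have fx := f0 (param i x); set c := (Num.sqrt (f (param i x)))^-1.
  have cc : f (param i x) * c * c = 1.
    rewrite -mulrA -invfM -expr2 sqr_sqrtr ?ltW// divff//; exact: lt0r_neq0.
  exists (c *: v), (c *: w).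
  by split; rewrite inner_rescale innerZl innerZr !mulrA cc mul1r.
Qed.

Lemma vector_fieldD V W : vector_field V -> vector_field W ->
  vector_field (fun i x => V i x + W i x).
Proof.
move=> [sV tV] [sW tW]; split=> [i a b|i j x ix jx].
  under eq_fun do rewrite mxE.
  by apply: smooth_onD; [exact: cod_open|exact: sV|exact: sW].
by rewrite tV// tW// mulmxDl.
Qed.

Lemma vector_fieldZ f V : smooth_function f -> vector_field V ->
  vector_field (fun i x => f (param i x) *: V i x).
Proof.
move=> sf [sV tV]; split=> [i a b|i j x ix jx].
  under eq_fun do rewrite mxE.
  by apply: smooth_onM; [exact: cod_open|exact: sf|exact: sV].
by rewrite tV// coordK// scalemxAl.
Qed.

Lemma smooth_function_cst (c : R) : smooth_function (fun _ : M => c).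
Proof. by move=> i; apply: smooth_on_cst; exact: cod_open. Qed.

Lemma vector_fieldZc (c : R) V : vector_field V ->
  vector_field (fun i x => c *: V i x).
Proof. by move=> ?; apply: (vector_fieldZ (smooth_function_cst c)). Qed.

Lemma vector_fieldN V : vector_field V -> vector_field (fun i x => - V i x).
Proof.
move=> /(vector_fieldZc (-1)); congr vector_field.
by apply/funext => i; apply/funext => x; rewrite scaleN1r.
Qed.

Lemma smooth_on_inner g V W i : lorentzian_metric g ->
  vector_field V -> vector_field W ->
  smooth_on (cod i) (fun x => inner g i x (V i x) (W i x)).
Proof.
move=> [sg _ _ _] [sV _] [sW _]; under eq_fun do rewrite innerE.
have oi := cod_open (i := i).
have sT a b : smooth_on (cod i) (fun x => V i x 0 a * g i x a b * W i x 0 b).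
  apply: smooth_onM => //; last exact: sW.
  by apply: smooth_onM => //; [exact: sV|exact: sg].
by apply: smooth_onD => //; apply: smooth_onD => //; apply: smooth_onD.
Qed.

(** A conformal factor has to be a function on [M], whereas [inner] lives in a chart. An arbitrary
    chart around [p] is chosen; the transformation laws make the value independent of the choice
    ([pairingE]). *)
Definition pairing g V W (p : M) : R :=
  let i := sval (cid (atlas_cover p)) in
  inner g i (Defs.coord i p) (V i (Defs.coord i p)) (W i (Defs.coord i p)).

Lemma pairingE g V W i x : lorentzian_metric g -> vector_field V ->
  vector_field W -> cod i x ->
  pairing g V W (param i x) = inner g i x (V i x) (W i x).
Proof.
move=> [_ gt _ _] [_ tV] [_ tW] ix; rewrite /pairing.
case: cid => j /= jx.
by rewrite tV// tW// /inner (gt i j)// trmx_mul !mulmxA.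
Qed.

Lemma smooth_pairing g V W : lorentzian_metric g -> vector_field V ->
  vector_field W -> smooth_function (pairing g V W).
Proof.
move=> gL hV hW i; apply: smooth_on_eq (smooth_on_inner i gL hV hW).
  exact: cod_open.
by move=> x ix /=; rewrite pairingE.
Qed.

Lemma pderiv_metric_sym g i x a b c : lorentzian_metric g -> cod i x ->
  pderiv a (fun y => g i y b c) x = pderiv a (fun y => g i y c b) x.
Proof.
move=> [_ _ gs _] ix; apply: (pderiv_eq_on (cod_open (i := i))) => // y iy.
by rewrite -[in LHS]gs// mxE.
Qed.

(** These are the Christoffel symbols of the first kind: lowering the upper index cancels the
    inverse metric. *)
Lemma christoffel_lower g i x a b l : lorentzian_metric g -> cod i x ->
  christoffel g i 0 a b x * g i x 0 l + christoffel g i 1 a b x * g i x 1 l =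
  2^-1 * (pderiv a (fun y => g i y b l) x + pderiv b (fun y => g i y a l) x
          - pderiv l (fun y => g i y a b) x).
Proof.
move=> gL ix; have gU := lorentzian_unitmx gL ix.
have [_ _ gs _] := gL.
pose T l' := pderiv a (fun y => g i y b l') x + pderiv b (fun y => g i y a l') x
  - pderiv l' (fun y => g i y a b) x.
rewrite -(big_I2 (fun k => christoffel g i k a b x * g i x k l)).
rewrite /christoffel.
under eq_bigr do rewrite -mulrA mulr_suml.
rewrite -mulr_sumr exchange_big/=; congr (_ * _).
transitivity (\sum_m T m * (m == l)%:R); last first.
  rewrite (bigD1 l)//= eqxx mulr1 big1 ?addr0// => m /negbTE ->.
  by rewrite mulr0.
apply: eq_bigr => m _; rewrite -/(T m).
under eq_bigr do rewrite mulrAC [_ * T m]mulrC.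
rewrite -mulr_sumr; congr (_ * _).
have /matrixP/(_ m l) := mulVmx gU; rewrite !mxE => <-.
apply: eq_bigr => k _; congr (_ * _).
(* The sum has the indices of the inverse transposed, which its symmetry repairs. *)
by rewrite -[in LHS](gs i x ix) -trmx_inv mxE.
Qed.

(** Metric compatibility of the Levi-Civita connection. After the product rule, it comes down to
    writing the derivatives of the metric through lowered Christoffel symbols. *)
Lemma pderiv_inner g V W i x a : lorentzian_metric g -> vector_field V ->
  vector_field W -> cod i x ->
  pderiv a (fun y => inner g i y (V i y) (W i y)) x =
  inner g i x (row a (covariant_derivative g V i x)) (W i x) +
  inner g i x (V i x) (row a (covariant_derivative g W i x)).
Proof.
move=> gL [sV _] [sW _] ix; have [sg _ gs _] := gL.
have oi := cod_open (i := i).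
have dV k := smooth_on_derivable (a := a) (sV i 0 k) ix.
have dW k := smooth_on_derivable (a := a) (sW i 0 k) ix.
have dg k l := smooth_on_derivable (a := a) (sg i k l) ix.
have dT k l : derivable (fun y => V i y 0 k * g i y k l * W i y 0 l) x
    (delta_mx 0 a) by exact: (derivableM (derivableM (dV k) (dg k l)) (dW l)).
have pT k l : pderiv a (fun y => V i y 0 k * g i y k l * W i y 0 l) x =
    (pderiv a (fun y => V i y 0 k) x * g i x k l
     + V i x 0 k * pderiv a (fun y => g i y k l) x) * W i x 0 l
    + V i x 0 k * g i x k l * pderiv a (fun y => W i y 0 l) x.
  rewrite (pderivM (f := fun y => V i y 0 k * g i y k l))//.
    by rewrite pderivM.
  exact: derivableM.
have innE : (fun y => inner g i y (V i y) (W i y)) =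
  fun y =>
    V i y 0 0 * g i y 0 0 * W i y 0 0 + V i y 0 0 * g i y 0 1 * W i y 0 1 +
    V i y 0 1 * g i y 1 0 * W i y 0 0 + V i y 0 1 * g i y 1 1 * W i y 0 1.
  by apply/funext => y; rewrite innerE.
rewrite innE pderivD//; last
  exact: (derivableD (derivableD (dT 0 0) (dT 0 1)) (dT 1 0)).
rewrite pderivD//; last exact: (derivableD (dT 0 0) (dT 0 1)).
rewrite pderivD// !pT !innerE !mxE !big_I2.
pose S b l := christoffel g i 0 a b x * g i x 0 l +
  christoffel g i 1 a b x * g i x 1 l.
(* In the symmetrized sum, the derivatives in the directions [b] and [l] cancel. *)
have SE b l : S b l + S l b = pderiv a (fun y => g i y b l) x.
  by rewrite /S !christoffel_lower// (pderiv_metric_sym a l b gL ix); field.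
by rewrite -!SE /S (metric10 (gs i x ix)); ring.
Qed.

End Connection.

(** * The divergence and its behaviour under conformal change *)

Section Divergence.
Variables (R : realType) (M : oriented_surface R).
Implicit Types (g : metric_components M) (V W X Y : vfield_components M).
Implicit Types (i : atlas M) (f : M -> R).

(* The derivative of log (sqrt |det g|) along the coordinate b. *)
Definition dlog_volume g i x b : R :=
  2^-1 * \sum_(a < 2) \sum_(l < 2)
    invmx (g i x) a l * pderiv b (fun y => g i y a l) x.

(** In the contracted symbol, the terms [d_a g_bl - d_l g_ab] are antisymmetric in [a] and [l], so
    they vanish against the symmetric inverse metric; only the derivative of the volume density
    remains. *)
Lemma divergenceE g V i x : lorentzian_metric g -> cod i x ->
  divergence g V i x = \sum_(a < 2) (pderiv a (fun y => V i y 0 a) x +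
    dlog_volume g i x a * V i x 0 a).
Proof.
move=> gL ix; have [_ _ gs _] := gL.
have inv10 : invmx (g i x) 1 0 = invmx (g i x) 0 1.
  by rewrite -[in LHS](gs i x ix) -trmx_inv mxE.
rewrite /divergence /mxtrace /dlog_volume !big_I2 !mxE !big_I2.
rewrite /christoffel !big_I2 inv10.
rewrite (pderiv_metric_sym 0 1 0 gL ix) (pderiv_metric_sym 1 1 0 gL ix).
by ring.
Qed.

Lemma divergenceZ g f V i x : lorentzian_metric g -> smooth_function f ->
  vector_field V -> cod i x ->
  divergence g (fun i x => f (param i x) *: V i x) i x =
  f (param i x) * divergence g V i x +
  \sum_(a < 2) pderiv a (f \o param i) x * V i x 0 a.
Proof.
move=> gL sf [sV _] ix; rewrite !divergenceE// mulr_sumr -big_split/=.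
apply: eq_bigr => a _; rewrite mxE.
have -> : pderiv a (fun y => (f (param i y) *: V i y) 0 a) x =
    pderiv a (f \o param i) x * V i x 0 a +
    f (param i x) * pderiv a (fun y => V i y 0 a) x.
  under eq_fun do rewrite mxE; apply: pderivM.
    exact: smooth_on_derivable (sf i) ix.
  exact: smooth_on_derivable (sV i 0 a) ix.
by ring.
Qed.

Lemma divergence_eq g V W i x : (forall y, cod i y -> V i y = W i y) ->
  cod i x -> divergence g V i x = divergence g W i x.
Proof.
move=> VW ix; congr (\tr _); apply/matrixP => a k; rewrite !mxE VW//.
congr (_ + _); apply: (pderiv_eq_on (cod_open (i := i))) => // y iy.
by rewrite VW.
Qed.

(** In dimension two the volume density is multiplied by exactly [f]: the trace of [g^-1 g] is 2 and
    cancels the factor 1/2. *)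
Lemma dlog_volume_rescale f g i x b : lorentzian_metric g ->
  smooth_function f -> (forall p, 0 < f p) -> cod i x ->
  dlog_volume (rescale f g) i x b =
  dlog_volume g i x b + pderiv b (f \o param i) x / f (param i x).
Proof.
move=> gL sf f0 ix; have [sg _ gs _] := gL.
have gU := lorentzian_unitmx gL ix.
have fx : f (param i x) != 0 by rewrite gt_eqF.
have pE a l : pderiv b (fun y => rescale f g i y a l) x =
    pderiv b (f \o param i) x * g i x a l +
    f (param i x) * pderiv b (fun y => g i y a l) x.
  rewrite /rescale; under eq_fun do rewrite mxE; apply: pderivM.
    exact: smooth_on_derivable (sf i) ix.
  exact: smooth_on_derivable (sg i a l) ix.
have tr2 : invmx (g i x) 0 0 * g i x 0 0 + invmx (g i x) 0 1 * g i x 0 1 +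
    (invmx (g i x) 1 0 * g i x 1 0 + invmx (g i x) 1 1 * g i x 1 1) = 2.
  have := mulVmx gU => /matrixP mV.
  have := mV 0 0; have := mV 1 1; rewrite !mxE !big_I2.
  by rewrite !(metric10 (gs i x ix)) /=; lra.
have invE a l : invmx (rescale f g i x) a l =
    (f (param i x))^-1 * invmx (g i x) a l.
  by rewrite /rescale invmxZ ?mxE// unitmxZ// unitfE.
rewrite /dlog_volume !big_I2 !pE !invE.
set u := pderiv b _ x; set c := f _ in fx *.
rewrite -[X in _ = _ + X]mulr1 (_ : 1 = 2^-1 * 2); last by field.
by rewrite -[X in _ = _ + _ * (_ * X)]tr2; field.
Qed.

(** The term [V(f)/f] gained from the volume density becomes, after multiplication by [f], the
    Leibniz term [V(f)] in the divergence of [f V]. *)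
Lemma divergence_rescale f g V i x : lorentzian_metric g ->
  smooth_function f -> (forall p, 0 < f p) -> vector_field V -> cod i x ->
  f (param i x) * divergence (rescale f g) V i x =
  divergence g (fun i x => f (param i x) *: V i x) i x.
Proof.
move=> gL sf f0 hV ix; rewrite divergenceZ//.
have fx : f (param i x) != 0 by rewrite gt_eqF.
rewrite !divergenceE//; last exact: lorentzian_rescale.
rewrite !mulr_sumr -big_split/=; apply: eq_bigr => a _.
by rewrite dlog_volume_rescale//; field.
Qed.

Lemma covariant_frameX g V W i x : vector_field V -> vector_field W ->
  cod i x -> covariant_derivative g (frameX V W) i x =
  covariant_derivative g V i x + covariant_derivative g W i x.
Proof.
move=> [sV _] [sW _] ix; apply/matrixP => a k; rewrite !mxE /frameX.
under eq_fun do rewrite mxE.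
rewrite pderivD; [|exact: smooth_on_derivable (sV i 0 k) ix
                  |exact: smooth_on_derivable (sW i 0 k) ix].
rewrite !big_I2 !mxE.
by ring.
Qed.

Lemma covariantN g V i x : vector_field V ->
  cod i x -> covariant_derivative g (fun i x => - V i x) i x =
  - covariant_derivative g V i x.
Proof.
move=> [sV _] ix; apply/matrixP => a k; rewrite !mxE.
under eq_fun do rewrite mxE.
have -> : pderiv a (fun y => - V i y 0 k) x = - pderiv a (fun y => V i y 0 k) x.
  by apply: deriveN; exact: smooth_on_derivable (sV i 0 k) ix.
by rewrite !big_I2 !mxE; ring.
Qed.

Lemma covariant_frameY g V W i x : vector_field V -> vector_field W ->
  cod i x -> covariant_derivative g (frameY V W) i x =
  - covariant_derivative g V i x + covariant_derivative g W i x.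
Proof.
move=> hV hW ix; rewrite -covariantN// -covariant_frameX//.
exact: vector_fieldN.
Qed.

End Divergence.

(** * Null frames and the reformulation of the three flatness notions *)

Section NullFrames.
Variables (R : realType) (M : oriented_surface R).
Implicit Types (g : metric_components M) (V W X Y : vfield_components M).
Implicit Types (i : atlas M) (f : M -> R).

Definition null_frame g X Y : Prop :=
  [/\ vector_field X, vector_field Y
    & forall i x, cod i x -> null_pair g i x (X i x) (Y i x)].

Lemma frame_null_frame g s1 s2 : lorentzian_metric g ->
  oriented_orthonormal_frame g s1 s2 ->
  null_frame g (frameX s1 s2) (frameY s1 s2).
Proof.
move=> [_ _ gs _] [v1 v2 on or]; split.
- exact: vector_fieldD.
- by apply: vector_fieldD => //; exact: vector_fieldN.
- move=> i x ix; have [e11 e22 e12] := on i x ix; have := or i x ix.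
  have e21 : inner g i x (s2 i x) (s1 i x) = 0 by rewrite (innerC (gs i x ix)).
  rewrite det_col_mx_cross /cross => o12; rewrite /frameX /frameY.
  split; rewrite ?(innerDl, innerDr, innerNl, innerNr) ?e11 ?e22 ?e12 ?e21.
  + lra.
  + lra.
  + lra.
  + by rewrite /cross !mxE; lra.
Qed.

(** Solving for the frame gives [s1 = (X - Y)/2] and [s2 = (X + Y)/2]. The fields are recovered as
    total functions, so conditions on [X] and [Y] transfer by rewriting. *)
Lemma null_frame_frame g X Y : lorentzian_metric g -> null_frame g X Y ->
  exists s1 s2, [/\ oriented_orthonormal_frame g s1 s2,
    frameX s1 s2 = X & frameY s1 s2 = Y].
Proof.
move=> [_ _ gs _] [hX hY nXY].
exists (fun i x => 2^-1 *: (X i x - Y i x)).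
exists (fun i x => 2^-1 *: (X i x + Y i x)).
split.
- split.
  + by apply/vector_fieldZc/vector_fieldD => //; exact: vector_fieldN.
  + exact/vector_fieldZc/vector_fieldD.
  + move=> i x ix; have [XX YY XY _] := nXY i x ix.
    have YX : inner g i x (Y i x) (X i x) = 2 by rewrite (innerC (gs i x ix)).
    by split; rewrite innerZl innerZr !(innerDl, innerDr, innerNl, innerNr)
      XX YY XY YX; lra.
  + move=> i x ix; have [_ _ _] := nXY i x ix.
    by rewrite det_col_mx_cross /cross !mxE; lra.
- apply/funext => i; apply/funext => x; rewrite /frameX -scalerDr.
  apply/matrixP => a b; rewrite !mxE; lra.
- apply/funext => i; apply/funext => x; rewrite /frameY.
  apply/matrixP => a b; rewrite !mxE; lra.
Qed.

Lemma null_frame_parallel g X Y : lorentzian_metric g -> null_frame g X Y ->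
  (forall i x, cod i x -> divergence g X i x = 0) ->
  (forall i x, cod i x -> divergence g Y i x = 0) ->
  parallel g X /\ parallel g Y.
Proof.
move=> gL [hX hY nXY] dX dY; have [_ _ gs _] := gL.
suff PQ i x : cod i x -> covariant_derivative g X i x = 0 /\
    covariant_derivative g Y i x = 0.
  by split=> i x /PQ[].
move=> ix; have oi := cod_open (i := i); have gsx := gs i x ix.
set P := covariant_derivative g X i x; set Q := covariant_derivative g Y i x.
have nx := nXY i x ix; have [XX YY XY c0] := nx.
(* The three pairings of [X] and [Y] are constant on the chart; differentiating each of them
   constrains [P] and [Q]. *)
have PX a : inner g i x (row a P) (X i x) = 0.
  have := pderiv_inner a gL hX hX ix.
  rewrite (@pderiv_cst_on _ _ oi a _ 0)//; last by move=> y /nXY[].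
  by rewrite [X in _ = _ + X](innerC gsx) -/P; lra.
have QY a : inner g i x (row a Q) (Y i x) = 0.
  have := pderiv_inner a gL hY hY ix.
  rewrite (@pderiv_cst_on _ _ oi a _ 0)//; last by move=> y /nXY[].
  by rewrite [X in _ = _ + X](innerC gsx) -/Q; lra.
have PYQX a : inner g i x (row a P) (Y i x) = - inner g i x (row a Q) (X i x).
  have := pderiv_inner a gL hX hY ix.
  rewrite (@pderiv_cst_on _ _ oi a _ 2)//; last by move=> y /nXY[].
  by rewrite [X in _ = _ + X](innerC gsx) -/Q -/P; lra.
(* The components of the connection form: [P] is [w] tensor [X] and [Q] is [- w] tensor [Y], with
   traces [w(X)] and [- w(Y)]. *)
pose w a := inner g i x (row a P) (Y i x) / 2.
have PE a : row a P = w a *: X i x.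
  by rewrite (null_pair_decomp gsx (row a P) nx) PX mul0r scale0r addr0.
have QE a : row a Q = - w a *: Y i x.
  rewrite (null_pair_decomp gsx (row a Q) nx) QY mul0r scale0r add0r /w.
  by rewrite PYQX mulNr opprK.
have Pe a k : P a k = w a * X i x 0 k.
  by have /rowP/(_ k) := PE a; rewrite !mxE.
have Qe a k : Q a k = - w a * Y i x 0 k.
  by have /rowP/(_ k) := QE a; rewrite !mxE.
have wX : w 0 * X i x 0 0 + w 1 * X i x 0 1 = 0.
  by have := dX i x ix; rewrite /divergence /mxtrace big_I2 -/P !Pe.
have wY : w 0 * Y i x 0 0 + w 1 * Y i x 0 1 = 0.
  by have := dY i x ix; rewrite /divergence /mxtrace big_I2 -/Q !Qe; lra.
have cN0 : cross (X i x) (Y i x) != 0 by rewrite gt_eqF.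
(* The form [w] vanishes on the independent vectors [X] and [Y]; the linear system is solved by
   elimination, with determinant [cross]. *)
have w0 : w 0 = 0.
  apply/eqP; rewrite -(mulIr_eq0 _ (mulIf cN0)); apply/eqP.
  transitivity ((w 0 * X i x 0 0 + w 1 * X i x 0 1) * Y i x 0 1
    - (w 0 * Y i x 0 0 + w 1 * Y i x 0 1) * X i x 0 1).
    by rewrite /cross; ring.
  by rewrite wX wY !mul0r subrr.
have w1 : w 1 = 0.
  apply/eqP; rewrite -(mulIr_eq0 _ (mulIf cN0)); apply/eqP.
  transitivity ((w 0 * Y i x 0 0 + w 1 * Y i x 0 1) * X i x 0 0
    - (w 0 * X i x 0 0 + w 1 * X i x 0 1) * Y i x 0 0).
    by rewrite /cross; ring.
  by rewrite wX wY !mul0r subrr.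
have w_0 a : w a = 0 by elim/ord2_ind: a.
by split; apply/matrixP => a k; rewrite ?Pe ?Qe w_0 mxE ?oppr0 mul0r.
Qed.

(** Parallelism of a frame is replaced by two scalar equations, which behave well under rescaling.
    One direction takes traces; the other is [null_frame_parallel], followed by recovering [s1] and
    [s2] from their sum and difference. *)
Lemma globally_flatP g : lorentzian_metric g ->
  globally_flat g <-> exists X Y, [/\ null_frame g X Y,
    forall i x, cod i x -> divergence g X i x = 0 &
    forall i x, cod i x -> divergence g Y i x = 0].
Proof.
move=> gL; split.
  move=> [s1 [s2 [fr p1 p2]]]; have [v1 v2 _ _] := fr.
  exists (frameX s1 s2), (frameY s1 s2); split; first exact: frame_null_frame.
  - move=> i x ix; rewrite /divergence covariant_frameX// p1// p2// addr0.
    exact: mxtrace0.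
  - move=> i x ix; rewrite /divergence covariant_frameY// p1// p2// addr0 oppr0.
    exact: mxtrace0.
move=> [X [Y [nXY dX dY]]].
have [pX pY] := null_frame_parallel gL nXY dX dY.
have [s1 [s2 [fr eX eY]]] := null_frame_frame gL nXY.
have [v1 v2 _ _] := fr; exists s1, s2; split=> //.
- move=> i x ix; have := pX i x ix; have := pY i x ix.
  rewrite -eX -eY covariant_frameX// covariant_frameY//.
  move=> /matrixP h1 /matrixP h2; apply/matrixP => a k.
  by have := h1 a k; have := h2 a k; rewrite !mxE; lra.
- move=> i x ix; have := pX i x ix; have := pY i x ix.
  rewrite -eX -eY covariant_frameX// covariant_frameY//.
  move=> /matrixP h1 /matrixP h2; apply/matrixP => a k.
  by have := h1 a k; have := h2 a k; rewrite !mxE; lra.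
Qed.

Lemma X_conformally_flatP g : lorentzian_metric g ->
  X_conformally_flat g <-> exists X Y, null_frame g X Y /\
    forall i x, cod i x -> divergence g X i x = 0.
Proof.
move=> gL; split=> [[s1 [s2 [fr dX]]]|[X [Y [nXY dX]]]].
  by exists (frameX s1 s2), (frameY s1 s2); split=> //; exact: frame_null_frame.
have [s1 [s2 [fr eX eY]]] := null_frame_frame gL nXY.
by exists s1, s2; rewrite eX.
Qed.

Lemma Y_conformally_flatP g : lorentzian_metric g ->
  Y_conformally_flat g <-> exists X Y, null_frame g X Y /\
    forall i x, cod i x -> divergence g Y i x = 0.
Proof.
move=> gL; split=> [[s1 [s2 [fr dY]]]|[X [Y [nXY dY]]]].
  by exists (frameX s1 s2), (frameY s1 s2); split=> //; exact: frame_null_frame.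
have [s1 [s2 [fr eX eY]]] := null_frame_frame gL nXY.
by exists s1, s2; rewrite eY.
Qed.

End NullFrames.

(** * Comparison of two null frames, and the equivalence *)

(** Pointwise alignment of the second null vectors gives the factor [g(X1,Y2)/2], smooth as a
    pairing of vector fields. Its sign is not controlled, since the two frames may have opposite
    time orientations. *)
Lemma null_frame_transition (R : realType) (M : oriented_surface R)
    (g : metric_components M) (X1 Y1 X2 Y2 : vfield_components M) :
  lorentzian_metric g -> null_frame g X1 Y1 -> null_frame g X2 Y2 ->
  exists k : M -> R, [/\ smooth_function k, forall p, k p != 0
    & forall i x, cod i x -> Y2 i x = k (param i x) *: Y1 i x].
Proof.
move=> gL [hX1 hY1 n1] [hX2 hY2 n2]; have [_ _ gs _] := gL.
exists (fun p => 2^-1 * pairing g X1 Y2 p).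
have kE i x : cod i x ->
    Y2 i x = (2^-1 * pairing g X1 Y2 (param i x)) *: Y1 i x.
  move=> ix; rewrite pairingE// mulrC.
  exact: (null_pairs_aligned (gs i x ix) (n1 i x ix) (n2 i x ix)).
split=> //.
- move=> i; apply: smooth_onM; [exact: cod_open| |exact: smooth_pairing].
  exact: smooth_function_cst.
(* A zero of the factor would make [Y2] vanish there, against [g(X2,Y2) = 2]. *)
- move=> p; have [i ip] := atlas_cover p.
  have ix := coord_cod ip; apply/negP => /eqP k0.
  have [_ _ + _] := n2 _ _ ix; rewrite kE// coordK// k0 innerZr mul0r.
  by move/eqP; rewrite eq_sym pnatr_eq0.
Qed.

Theorem mainTheorem5 (R : realType) (M : oriented_surface R)
    (g : metric_components M)
    (g_lorentzian : lorentzian_metric g)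
    (g_time_orientable : time_orientable g) :
  conformally_flat g <-> X_conformally_flat g /\ Y_conformally_flat g.
Proof.
have gL := g_lorentzian.
rewrite X_conformally_flatP// Y_conformally_flatP//; split.
  move=> [f [sf f0 /(globally_flatP (lorentzian_rescale sf f0 gL))]].
  move=> [X [Y [[hX hY nXY] dX dY]]].
  have hfX := vector_fieldZ sf hX; have hfY := vector_fieldZ sf hY.
  split.
  (* Moving the factor [f] from the metric to one field keeps the pairing:
     [g(f X, Y) = (f g)(X, Y) = 2]. *)
  - exists (fun i x => f (param i x) *: X i x), Y; split; last first.
      by move=> i x ix; rewrite -divergence_rescale// dX// mulr0.
    split=> // i x /nXY[]; rewrite !inner_rescale => XX YY XY c0.
    have fx := f0 (param i x).
    have fN0 : f (param i x) != 0 by rewrite gt_eqF.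
    split.
    + by rewrite innerZl innerZr XX mulr0.
    + by move/eqP: YY; rewrite mulf_eq0 (negbTE fN0) => /eqP.
    + by rewrite innerZl.
    + by rewrite crossZl mulr_gt0.
  - exists X, (fun i x => f (param i x) *: Y i x); split; last first.
      by move=> i x ix; rewrite -divergence_rescale// dY// mulr0.
    split=> // i x /nXY[]; rewrite !inner_rescale => XX YY XY c0.
    have fx := f0 (param i x).
    have fN0 : f (param i x) != 0 by rewrite gt_eqF.
    split.
    + by move/eqP: XX; rewrite mulf_eq0 (negbTE fN0) => /eqP.
    + by rewrite innerZl innerZr YY mulr0.
    + by rewrite innerZr.
    + by rewrite crossZr mulr_gt0.
move=> [[X1 [Y1 [n1 dX1]]] [X2 [Y2 [n2 dY2]]]].
have [k [sk k0 Y2E]] := null_frame_transition gL n1 n2.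
(* A conformal factor must be positive, while [k] is only nonzero. *)
pose f p := `|k p|.
have f0 p : 0 < f p by rewrite normr_gt0.
have sf : smooth_function f.
  by move=> i; apply: smooth_on_norm => //; exact: cod_open.
have sfV : smooth_function (fun p => (f p)^-1).
  move=> i; apply: smooth_onV; [exact: cod_open| |exact: sf].
  by move=> x _; rewrite gt_eqF.
have ssg : smooth_function (fun p => Num.sg (k p)).
  by move=> i; apply: smooth_on_sg => //; exact: cod_open.
have [hX1 hY1 nXY] := n1; have [_ hY2 _] := n2.
exists f; split=> //; apply/(globally_flatP (lorentzian_rescale sf f0 gL)).
(* Dividing [X1] by [f] restores the pairing 2 for the metric [f g], and [f] times the new field is
   [X1], which is divergence free for [g]. *)
exists (fun i x => (f (param i x))^-1 *: X1 i x), Y1.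
have hX := vector_fieldZ sfV hX1.
have fN0 p : f p != 0 by rewrite gt_eqF.
split.
- split=> // i x ix; have [XX YY XY c0] := nXY i x ix.
  split; rewrite ?inner_rescale ?innerZl ?innerZr ?XX ?YY ?XY ?mulr0//.
  + by rewrite mulrA divff// mul1r.
  + by rewrite crossZl mulr_gt0// invr_gt0.
- move=> i x ix; apply: (mulfI (fN0 (param i x))); rewrite mulr0.
  rewrite divergence_rescale// -[RHS](dX1 i x ix); apply: divergence_eq ix.
  by move=> y iy; rewrite scalerA divff// scale1r.
- move=> i x ix; apply: (mulfI (fN0 (param i x))); rewrite mulr0.
  rewrite divergence_rescale//.
  (* |k| Y1 = sg k Y2, and sg k is locally constant. *)
  rewrite (@divergence_eq _ _ _ _
    (fun i x => Num.sg (k (param i x)) *: Y2 i x))//.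
    rewrite (divergenceZ gL ssg hY2 ix) dY2// mulr0 add0r big1// => a _.
    rewrite [X in X * _](_ : _ = 0) ?mul0r//.
    rewrite /pderiv (near_eq_derive _ (g := cst (Num.sg (k (param i x)))))//.
      exact: derive_cst.
    exact: (near_sg_cst (sk i) ix (k0 _)).
  by move=> y iy; rewrite Y2E// scalerA -normrEsg.
Qed.
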